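(* There is a polynomial-time procedure which, given an instance of Directed Multicut consisting of a directed graph $G$, terminal pairs $(s_1,t_1),\dots,(s_k,t_k)$ and a budget $p$, produces an instance of Lattice Cut (a directed graph $G'$, a set $T$ of at most $2k$ terminal vertices, a poset $P$ and a surjective map $\ell:T\to P$) such that the Lattice Cut instance has a solution with at most $p$ edges if and only if the Directed Multicut instance has a solution with at most $p$ edges. Consequently, if Lattice Cut is fixed-parameter tractable, then so is Directed Multicut.
   Context: Directed Multicut: given a directed graph $G$ and pairs of vertices $(s_1,t_1),\dots,(s_k,t_k)$, find a smallest set of edges whose deletion eliminates all directed paths from $s_i$ to $t_i$ for every $i$. Lattice Cut: given a directed graph $G=(V,E)$, a set of terminal vertices $T\subseteq V$, a partially ordered set $P$ and a surjective map $\ell:T\to P$, find a minimum set $S\subseteq E$ such that for all $x,y\in T$, if there is a directed path from $x$ to $y$ in $(V,E\setminus S)$ then $\ell(x)\ge_P \ell(y)$. A problem is fixed-parameter tractable (FPT) in parameters $k$ (number of terminals/terminal pairs) and $p$ (size of the cutset) if there is an algorithm which, on input $x$, either outputs a solution of size at most $p$ or correctly decides that none exists, in at most $f(k,p)\cdot\mathrm{poly}(|x|)$ steps for some computable $f$. *)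

(* Defs.v *)
From HB Require Import structures.
From mathcomp Require Import all_boot all_order.

Set Implicit Arguments.
Unset Strict Implicit.
Unset Printing Implicit Defensive.

(** * Directed Multicut and Lattice Cut *)

(* A finite simple digraph is a vertex type V with an edge set E : {set V * V}.
   The empty path counts as a path, so every vertex reaches itself. *)
Definition reachable (V : finType) (E : {set V * V}) : rel V :=
  connect [rel x y | (x, y) \in E].

Record multicut_instance := MulticutInstance {
  dm_V : finType;
  dm_E : {set dm_V * dm_V};
  dm_pairs : seq (dm_V * dm_V) }.

Definition is_multicut (I : multicut_instance) (S : {set dm_V I * dm_V I}) :=
  S \subset dm_E I /\
  forall st, st \in dm_pairs I -> ~~ reachable (dm_E I :\: S) st.1 st.2.

Record lattice_instance := LatticeInstance {
  lc_V : finType;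
  lc_E : {set lc_V * lc_V};
  lc_T : {set lc_V};
  lc_disp : Order.disp_t;
  lc_P : finPOrderType lc_disp;
  lc_label : {x : lc_V | x \in lc_T} -> lc_P;
  lc_label_surj : forall a : lc_P, exists x, lc_label x = a }.

Definition is_lattice_cut (I : lattice_instance) (S : {set lc_V I * lc_V I}) :=
  S \subset lc_E I /\
  forall x y : {v : lc_V I | v \in lc_T I},
    reachable (lc_E I :\: S) (val x) (val y) ->
    (lc_label y <= lc_label x)%O.

(** * Model of computation *)

(* Structured programs over binary trees (Jones's language WHILE).  Evaluating
   an expression costs the total number of nodes of the values of all of its
   subexpressions, so that running times, and the sizes of the outputs, agree
   with those of Turing machines up to a polynomial. *)

Inductive data := Leaf | Node of data & data.

Fixpoint dsize (d : data) : nat :=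
  if d is Node a b then (dsize a + dsize b).+1 else 1.

Fixpoint data_eq (d e : data) : bool :=
  match d, e with
  | Leaf, Leaf => true
  | Node a b, Node a' b' => data_eq a a' && data_eq b b'
  | _, _ => false
  end.

Inductive expr :=
  | EVar of nat
  | ELeaf
  | ENode of expr & expr
  | ELeft of expr
  | ERight of expr
  | EEq of expr & expr.

Definition store := nat -> data.

Fixpoint eval (s : store) (e : expr) : data :=
  match e with
  | EVar i => s i
  | ELeaf => Leaf
  | ENode a b => Node (eval s a) (eval s b)
  | ELeft a => if eval s a is Node u _ then u else Leaf
  | ERight a => if eval s a is Node _ v then v else Leaf
  | EEq a b => if data_eq (eval s a) (eval s b) then Node Leaf Leaf else Leaf
  end.

Fixpoint cost (s : store) (e : expr) : nat :=
  dsize (eval s e) +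
  match e with
  | EVar _ | ELeaf => 0
  | ENode a b | EEq a b => cost s a + cost s b
  | ELeft a | ERight a => cost s a
  end.

Inductive prog :=
  | Assign of nat & expr
  | Seq of prog & prog
  | If of expr & prog & prog
  | While of expr & prog.

Definition update (s : store) (i : nat) (d : data) : store :=
  fun j => if j == i then d else s j.

(* [exec c s t s']: from store s, program c halts in store s' after t steps. *)
Inductive exec : prog -> store -> nat -> store -> Prop :=
  | ExecAssign s i e :
      exec (Assign i e) s (cost s e) (update s i (eval s e))
  | ExecSeq c1 c2 s s1 s2 t1 t2 :
      exec c1 s t1 s1 -> exec c2 s1 t2 s2 -> exec (Seq c1 c2) s (t1 + t2) s2
  | ExecIfTrue e c1 c2 s s' t :
      eval s e <> Leaf -> exec c1 s t s' ->
      exec (If e c1 c2) s (cost s e + t) s'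
  | ExecIfFalse e c1 c2 s s' t :
      eval s e = Leaf -> exec c2 s t s' ->
      exec (If e c1 c2) s (cost s e + t) s'
  | ExecWhileTrue e c s s1 s2 t1 t2 :
      eval s e <> Leaf -> exec c s t1 s1 -> exec (While e c) s1 t2 s2 ->
      exec (While e c) s (cost s e + t1 + t2) s2
  | ExecWhileFalse e c s :
      eval s e = Leaf -> exec (While e c) s (cost s e) s.

(* [run c x y t]: on input x, program c outputs y after t steps; variable 0
   holds the input at the start and the output at the end. *)
Definition run (c : prog) (x y : data) (t : nat) : Prop :=
  exists2 s', exec c (update (fun=> Leaf) 0 x) t s' & s' 0 = y.

(** * Encoding of instances *)

Fixpoint code_nat (n : nat) : data :=
  if n is m.+1 then Node Leaf (code_nat m) else Leaf.

Definition code_seq (A : Type) (f : A -> data) (s : seq A) : data :=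
  foldr (fun a d => Node (f a) d) Leaf s.

(* A finite set is encoded by any duplicate-free list of its elements. *)
Definition codes_set (A : finType) (f : A -> data) (X : {set A}) (d : data) :=
  exists2 s : seq A, perm_eq s (enum X) & d = code_seq f s.

(* The elements of a finite type are named 0, ..., #|A| - 1. *)
Definition code_elt (A : finType) (a : A) : data := code_nat (enum_rank a).

Definition code_pair (A B : finType) (ab : A * B) : data :=
  Node (code_elt ab.1) (code_elt ab.2).

Definition codes_multicut (I : multicut_instance) (d : data) : Prop :=
  exists2 e, codes_set (@code_pair _ _) (dm_E I) e &
    d = Node (code_nat #|dm_V I|)
          (Node e (code_seq (@code_pair _ _) (dm_pairs I))).

(* T and its labelling are given together, by the list of all (x, label of x);
   P is given by its number of elements and the list of all (a, b), a <= b. *)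
Definition codes_lattice (I : lattice_instance) (d : data) : Prop :=
  exists e l r,
    [/\ codes_set (@code_pair _ _) (lc_E I) e,
        codes_set (fun x => code_pair (val x, lc_label x))
          [set: {x : lc_V I | x \in lc_T I}] l,
        codes_set (@code_pair _ _)
          [set ab : lc_P I * lc_P I | (ab.1 <= ab.2)%O] r &
        d = Node (Node (code_nat #|lc_V I|) e)
              (Node l (Node (code_nat #|lc_P I|) r))].

(** * Cut problems and fixed-parameter tractability *)

Record cut_problem := CutProblem {
  instance : Type;
  vertices : instance -> finType;
  cuts : forall I, {set vertices I * vertices I} -> Prop;
  num_terminals : instance -> nat;
  codes : instance -> data -> Prop }.

Definition directed_multicut : cut_problem :=
  @CutProblem multicut_instance dm_V is_multicut
    (fun I => size (dm_pairs I)) codes_multicut.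

Definition lattice_cut : cut_problem :=
  @CutProblem lattice_instance lc_V is_lattice_cut
    (fun I => #|lc_T I|) codes_lattice.

Definition solution (Q : cut_problem) (I : instance Q) (p : nat)
    (S : {set vertices I * vertices I}) : Prop :=
  cuts S /\ #|S| <= p.
Arguments solution : clear implicits.

Definition codes_input (Q : cut_problem) (I : instance Q) (p : nat)
    (x : data) : Prop :=
  exists2 d, codes I d & x = Node d (code_nat p).
Arguments codes_input : clear implicits.

(* The output is a tagged solution, or Leaf if there is none. *)
Definition answers (Q : cut_problem) (I : instance Q) (p : nat)
    (y : data) : Prop :=
  (exists (S : {set vertices I * vertices I}) d, [/\ solution Q I p S, codes_set (@code_pair _ _) S d &
                   y = Node Leaf d])
  \/ (y = Leaf /\ ~ exists S : {set vertices I * vertices I}, solution Q I p S).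

Definition computable2 (f : nat -> nat -> nat) : Prop :=
  exists c, forall k p, exists t,
    run c (Node (code_nat k) (code_nat p)) (code_nat (f k p)) t.

Definition fpt (Q : cut_problem) : Prop :=
  exists (c : prog) (f : nat -> nat -> nat) (a b : nat), computable2 f /\
    forall (I : instance Q) (p : nat) (x : data), codes_input Q I p x ->
      exists y t, [/\ run c x y t, answers I p y &
        t <= f (num_terminals I) p * (a * dsize x ^ b)].

(* Main.v *)
(* A pair (s_i, t_i) gets two fresh terminals, a source x_i and a sink y_i, with
   p + 1 parallel paths of length 2 from x_i to s_i and from t_i to y_i, which
   no p edges can cut.  The poset is the crown in which y_j lies below x_i
   exactly when i <> j, so that the only forbidden connections are those from
   x_i to y_i; sources have no incoming and sinks no outgoing edges.  A cut of
   the new graph restricts to a multicut, and a multicut is a cut.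

   The running times come from closing the polynomial-time functions on binary
   trees under composition, pairing, conditionals and folds that increase their
   accumulator by an amount independent of it; the reduction is a nest of list
   comprehensions, which are such folds. *)

Require Import Defs.
From HB Require Import structures.
From mathcomp Require Import all_boot all_order.
From mathcomp Require Import zify.

Set Implicit Arguments.
Unset Strict Implicit.
Unset Printing Implicit Defensive.

(** * Programs as subroutines *)

(** The folds reverse what they build, so the lists produced by the reduction are mostly controlled
    up to permutation only; this suffices because a set may be listed in any order. Order matters in
    one place: four families of edges must agree on the number of each copy of a pair. The list [Q]
    of copies is therefore fixed first, and the target graph is built from whatever order [Q] comes
    out in. Pairs may repeat, so they are told apart by position, and the position used is the
    length of the tail behind an element, which a fold can compute. For tractability an equivalence
    of decision problems is not enough: a multicut must be returned, so a second program translates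
    the answer back. It relies on the original vertices keeping their numbers in the new graph.
    Finally, the costs of both programs are added to that of the given solver, while the definition
    asks for a product; hence [f k p] becomes [f (k + k) p + 1], with 2k the number of new
    terminals. *)

Lemma dsize_gt0 d : 0 < dsize d.
Proof. by case: d. Qed.

Fixpoint expr_vars (e : expr) : nat :=
  match e with
  | EVar i => i.+1
  | ELeaf => 0
  | ENode a b | EEq a b => maxn (expr_vars a) (expr_vars b)
  | ELeft a | ERight a => expr_vars a
  end.

Fixpoint prog_vars (c : prog) : nat :=
  match c with
  | Assign i e => maxn i.+1 (expr_vars e)
  | Seq c1 c2 => maxn (prog_vars c1) (prog_vars c2)
  | If e c1 c2 => maxn (expr_vars e) (maxn (prog_vars c1) (prog_vars c2))
  | While e c1 => maxn (expr_vars e) (prog_vars c1)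
  end.

Fixpoint expr_shift (M : nat) (e : expr) : expr :=
  match e with
  | EVar i => EVar (M + i)
  | ELeaf => ELeaf
  | ENode a b => ENode (expr_shift M a) (expr_shift M b)
  | ELeft a => ELeft (expr_shift M a)
  | ERight a => ERight (expr_shift M a)
  | EEq a b => EEq (expr_shift M a) (expr_shift M b)
  end.

Fixpoint prog_shift (M : nat) (c : prog) : prog :=
  match c with
  | Assign i e => Assign (M + i) (expr_shift M e)
  | Seq c1 c2 => Seq (prog_shift M c1) (prog_shift M c2)
  | If e c1 c2 => If (expr_shift M e) (prog_shift M c1) (prog_shift M c2)
  | While e c1 => While (expr_shift M e) (prog_shift M c1)
  end.

Lemma eval_shift M n (s u : store) e :
  (forall i, i < n -> u (M + i) = s i) -> expr_vars e <= n ->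
  eval u (expr_shift M e) = eval s e /\ cost u (expr_shift M e) = cost s e.
Proof.
move=> su; elim: e => [i||a IHa b IHb|a IHa|a IHa|a IHa b IHb] //=.
- by move=> /su ->.
- by rewrite geq_max => /andP[/IHa[-> ->] /IHb[-> ->]].
- by move=> /IHa[-> ->].
- by move=> /IHa[-> ->].
- by rewrite geq_max => /andP[/IHa[-> ->] /IHb[-> ->]].
Qed.

(** Only variables below [prog_vars c] are read or written, so agreement on the first [n] variables
    is all that is asked. Stores are infinite, and a program can reset only finitely many
    variables. *)
Lemma exec_shift M n c s t s' :
  exec c s t s' -> prog_vars c <= n ->
  forall u : store, (forall i, i < n -> u (M + i) = s i) ->
  exists u', [/\ exec (prog_shift M c) u t u',
    forall i, i < n -> u' (M + i) = s' i & forall j, j < M -> u' j = u j].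
Proof.
elim=> {c s t s'} [s i e|c1 c2 s s1 s2 t1 t2 _ IH1 _ IH2
  |e c1 c2 s s' t es _ IH|e c1 c2 s s' t es _ IH
  |e c s s1 s2 t1 t2 es _ IH1 _ IH2|e c s es] /=.
- rewrite geq_max => /andP[_ en] u su.
  have [ev co] := eval_shift su en.
  exists (update u (M + i) (eval s e)); split.
  + rewrite -co -ev; exact: ExecAssign.
  + by move=> j jn; rewrite /update eqn_add2l su.
  + by move=> j jM; rewrite /update; case: eqP => // ?; lia.
- rewrite geq_max => /andP[n1 n2] u su.
  have [u1 [x1 e1 o1]] := IH1 n1 _ su.
  have [u2 [x2 e2 o2]] := IH2 n2 _ e1.
  exists u2; split=> //; first exact: ExecSeq x1 x2.
  by move=> j jM; rewrite o2 ?o1.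
- rewrite !geq_max => /andP[en /andP[n1 _]] u su.
  have [ev co] := eval_shift su en.
  have [u1 [x1 e1 o1]] := IH n1 _ su.
  by exists u1; split=> //; rewrite -co; apply: ExecIfTrue; rewrite ?ev.
- rewrite !geq_max => /andP[en /andP[_ n2]] u su.
  have [ev co] := eval_shift su en.
  have [u1 [x1 e1 o1]] := IH n2 _ su.
  by exists u1; split=> //; rewrite -co; apply: ExecIfFalse; rewrite ?ev.
- rewrite geq_max => /andP[en n1] u su.
  have [ev co] := eval_shift su en.
  have [u1 [x1 e1 o1]] := IH1 n1 _ su.
  have [|u2 [x2 e2 o2]] := IH2 _ _ e1; first by rewrite /= geq_max en.
  exists u2; split=> //; last by move=> j jM; rewrite o2 ?o1.
  by rewrite -co; apply: ExecWhileTrue x1 x2; rewrite ?ev.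
- rewrite geq_max => /andP[en n1] u su.
  have [ev co] := eval_shift su en.
  by exists u; split=> //; rewrite -co; apply: ExecWhileFalse; rewrite ev.
Qed.

(** Variable [M] is spared because it holds the argument. The language has no skip, so the base case
    assigns [M] to itself, whence the term [dsize (s M)] in the running time. *)
Fixpoint clear (M n : nat) : prog :=
  if n is m.+1 then Seq (clear M m) (Assign (M + n) ELeaf)
  else Assign M (EVar M).

Lemma exec_clear M n s : exists u,
  [/\ exec (clear M n) s (dsize (s M) + n) u, u M = s M,
      forall i, 0 < i <= n -> u (M + i) = Leaf & forall j, j < M -> u j = s j].
Proof.
elim: n => [|n [u [x uM ui uj]]] /=.
  exists (update s M (s M)); split; last 2 first.
  - by case.
  - by move=> j jM; rewrite /update; case: eqP => // ?; lia.
  - by have := ExecAssign s M (EVar M); rewrite /= !addn0.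
  - by rewrite /update eqxx.
exists (update u (M + n.+1) Leaf); split.
- have -> : dsize (s M) + n.+1 = dsize (s M) + n + 1 by lia.
  exact: ExecSeq x (ExecAssign _ _ ELeaf).
- by rewrite /update; case: eqP => // ?; lia.
- move=> i ilen; rewrite /update eqn_add2l; case: eqP => // ?.
  by apply: ui; lia.
- by move=> j jM; rewrite /update; case: eqP => [?|_]; [lia|apply: uj].
Qed.

(* [call M c e] runs [c] on the value of [e] in the variables from M upwards,
   which are cleared first, so that it can be used in any store. *)
Definition call (M : nat) (c : prog) (e : expr) : prog :=
  Seq (Seq (Assign M e) (clear M (prog_vars c))) (prog_shift M c).

Lemma exec_call M c e s y t : run c (eval s e) y t ->
  exists u, [/\ exec (call M c e) s
      (cost s e + (dsize (eval s e) + prog_vars c) + t) u,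
    u M = y & forall j, j < M -> u j = s j].
Proof.
move=> [s' x <-]; set s1 := update s M (eval s e).
have [u1 [x1 u1M u1i u1j]] := exec_clear M (prog_vars c) s1.
have s1M : s1 M = eval s e by rewrite /s1 /update eqxx.
rewrite s1M in x1 u1M.
(* The bound [(prog_vars c).+1] is positive whatever [c] is, so that index 0, the output, is
   covered. *)
have [|u2 [x2 u2i u2j]] := @exec_shift M (prog_vars c).+1 _ _ _ _ x (leqnSn _) u1.
  case=> [_|i ilt]; first by rewrite addn0 u1M.
  by rewrite u1i // /update.
exists u2; split.
- apply: ExecSeq x2; apply: ExecSeq x1; exact: ExecAssign.
- by rewrite -[M in LHS]addn0 u2i.
- move=> j jM; rewrite u2j // u1j // /s1 /update.
  by case: eqP => // ?; lia.
Qed.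

Lemma dsize_eval_cost s e : dsize (eval s e) <= cost s e.
Proof. by case: e => *; apply: leq_addr. Qed.

(** An assignment costs at least the size of the value stored. This is how a time bound yields a
    bound on the size of the output. *)
Lemma exec_dsize c s t s' i : exec c s t s' -> dsize (s' i) <= dsize (s i) + t.
Proof.
elim=> {c s t s'} [s j e|c1 c2 s s1 s2 t1 t2 _ IH1 _ IH2
  |e c1 c2 s s' t es _ IH|e c1 c2 s s' t es _ IH
  |e c s s1 s2 t1 t2 es _ IH1 _ IH2|e c s es]; try lia.
rewrite /update; case: eqP => _; last exact: leq_addr.
by apply: leq_trans (dsize_eval_cost s e) (leq_addl _ _).
Qed.

Lemma run_dsize c x y t : run c x y t -> dsize y <= dsize x + t.
Proof. by move=> [s' /(exec_dsize 0) + <-]; rewrite /update eqxx. Qed.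

(** * Polynomial time *)

Definition pbounded (g : data -> nat) : Prop :=
  exists a b, forall x, g x <= a * dsize x ^ b.

Lemma pbounded_le g h : (forall x, g x <= h x) -> pbounded h -> pbounded g.
Proof.
by move=> gh [a [b hP]]; exists a, b => x; apply: leq_trans (gh x) (hP x).
Qed.

Lemma pbounded_const n : pbounded (fun=> n).
Proof. by exists n, 0 => x; rewrite muln1. Qed.

Lemma pbounded_dsize : pbounded dsize.
Proof. by exists 1, 1 => x; rewrite mul1n expn1. Qed.

(** Single monomials are closed under sums because [dsize x] is at least 1, so both exponents can be
    raised to [b + b']. *)
Lemma pboundedD g h :
  pbounded g -> pbounded h -> pbounded (fun x => g x + h x).
Proof.
move=> [a [b gP]] [a' [b' hP]]; exists (a + a'), (b + b') => x.
rewrite mulnDl leq_add //.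
  apply: leq_trans (gP x) _; rewrite leq_mul2l leq_pexp2l ?orbT ?dsize_gt0 //.
  exact: leq_addr.
apply: leq_trans (hP x) _; rewrite leq_mul2l leq_pexp2l ?orbT ?dsize_gt0 //.
exact: leq_addl.
Qed.

Lemma pboundedM g h :
  pbounded g -> pbounded h -> pbounded (fun x => g x * h x).
Proof.
move=> [a [b gP]] [a' [b' hP]]; exists (a * a'), (b + b') => x.
by rewrite expnD mulnACA leq_mul.
Qed.

Lemma pboundedX g n : pbounded g -> pbounded (fun x => g x ^ n).
Proof.
move=> gP; elim: n => [|n IH]; first exact: pbounded_const.
by apply: pbounded_le (pboundedM gP IH) => x; rewrite expnS.
Qed.

Lemma pbounded_comp g (f : data -> data) :
  pbounded g -> pbounded (fun x => dsize (f x)) -> pbounded (fun x => g (f x)).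
Proof.
move=> [a [b gP]] fP; apply: pbounded_le (fun x => gP (f x)) _.
by apply: pboundedM (pbounded_const a) (pboundedX b fP).
Qed.

Ltac pbounded_auto := repeat first
  [ assumption | exact: pbounded_dsize | exact: pbounded_const
  | apply: pboundedD | apply: pboundedM | apply: pboundedX ].

Lemma leq_expn2l m n e : m <= n -> m ^ e <= n ^ e.
Proof. by move=> mn; case: e => // e; rewrite leq_exp2r. Qed.

Definition ptime (f : data -> data) : Prop :=
  exists c T, pbounded T /\ forall x, exists2 t, run c x (f x) t & t <= T x.

Lemma ptime_dsize f : ptime f -> pbounded (fun x => dsize (f x)).
Proof.
move=> [c [T [TP cP]]]; apply: pbounded_le (pboundedD pbounded_dsize TP) => x.
by have [t /run_dsize] := cP x; lia.
Qed.

(** The program and its bound come before [M], [e] and [s], so one subroutine serves every call. The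
    cost of evaluating the argument stays apart, as it depends on the caller. *)
Lemma ptime_call f : ptime f -> exists c T, pbounded T /\
  forall M e s x, eval s e = x -> exists t u,
    [/\ exec (call M c e) s (cost s e + t) u,
        t <= T x, u M = f x & forall j, j < M -> u j = s j].
Proof.
move=> [c [T [TP cP]]].
exists c, (fun x => dsize x + prog_vars c + T x); split.
  by pbounded_auto.
move=> M e s x ex; have [t + tT] := cP x.
rewrite -{1}ex => /(exec_call M)[u [xu uM uj]].
exists (dsize x + prog_vars c + t), u; split=> //.
  by rewrite addnA -ex.
by rewrite leq_add2l.
Qed.

Lemma ptime_assign e :
  pbounded (fun x => cost (update (fun=> Leaf) 0 x) e) ->
  ptime (fun x => eval (update (fun=> Leaf) 0 x) e).
Proof.
move=> eP; exists (Assign 0 e); eexists; split; first exact: eP.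
move=> x; eexists; last exact: leqnn.
by eexists; first exact: ExecAssign.
Qed.

Lemma ptime_id : ptime id.
Proof.
apply: (@ptime_assign (EVar 0)).
by apply: pbounded_le pbounded_dsize => x; rewrite /= addn0.
Qed.

Lemma ptime_leaf : ptime (fun=> Leaf).
Proof. by apply: (@ptime_assign ELeaf); exact: (pbounded_const 1). Qed.

Lemma ptime_comp g f : ptime g -> ptime f -> ptime (fun x => g (f x)).
Proof.
move=> gP fP; have fS := ptime_dsize fP; have gS := ptime_dsize gP.
have [cf [Tf [TfP fC]]] := ptime_call fP.
have [cg [Tg [TgP gC]]] := ptime_call gP.
exists (Seq (Seq (call 1 cf (EVar 0)) (call 1 cg (EVar 1))) (Assign 0 (EVar 1))).
exists (fun x => dsize x + Tf x + (dsize (f x) + Tg (f x)) + dsize (g (f x))).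
split.
  have := pbounded_comp TgP fS; have := pbounded_comp gS fS.
  by move=> *; pbounded_auto.
move=> x; pose s := update (fun=> Leaf) 0 x.
have [t1 [u1 [x1 b1 e1 o1]]] := fC 1 (EVar 0) s x erefl.
have [t2 [u2 [x2 b2 e2 o2]]] := gC 1 (EVar 1) u1 _ e1.
eexists.
  eexists; first exact: ExecSeq (ExecSeq x1 x2) (ExecAssign _ _ _).
  by rewrite /update /= e2.
have s0 : s 0 = x by [].
by rewrite /= e2 e1 s0; lia.
Qed.

Definition dleft (d : data) : data := if d is Node a _ then a else Leaf.
Definition dright (d : data) : data := if d is Node _ b then b else Leaf.
Definition dtest (d e : data) : data :=
  if data_eq d e then Node Leaf Leaf else Leaf.

Lemma dsize_dleft d : dsize (dleft d) <= dsize d.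
Proof. by case: d => //= a b; lia. Qed.

Lemma dsize_dright d : dsize (dright d) <= dsize d.
Proof. by case: d => //= a b; lia. Qed.

Lemma ptime_dleft f : ptime f -> ptime (fun x => dleft (f x)).
Proof.
apply: ptime_comp; apply: (@ptime_assign (ELeft (EVar 0))).
apply: pbounded_le (pboundedD pbounded_dsize pbounded_dsize) => x /=.
by rewrite /update /= addn0 leq_add2r dsize_dleft.
Qed.

Lemma ptime_dright f : ptime f -> ptime (fun x => dright (f x)).
Proof.
apply: ptime_comp; apply: (@ptime_assign (ERight (EVar 0))).
apply: pbounded_le (pboundedD pbounded_dsize pbounded_dsize) => x /=.
by rewrite /update /= addn0 leq_add2r dsize_dright.
Qed.

Lemma ptime_pair f g : ptime f -> ptime g -> ptime (fun x => Node (f x) (g x)).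
Proof.
move=> fP gP; have fS := ptime_dsize fP; have gS := ptime_dsize gP.
have [cf [Tf [TfP fC]]] := ptime_call fP.
have [cg [Tg [TgP gC]]] := ptime_call gP.
exists (Seq (Seq (call 1 cf (EVar 0)) (call 2 cg (EVar 0)))
  (Assign 0 (ENode (EVar 1) (EVar 2)))).
exists (fun x => dsize x + Tf x + (dsize x + Tg x)
  + ((dsize (f x) + dsize (g x) + 1) + (dsize (f x) + dsize (g x)))).
split.
  by pbounded_auto.
move=> x; pose s := update (fun=> Leaf) 0 x.
have [t1 [u1 [x1 b1 e1 o1]]] := fC 1 (EVar 0) s x erefl.
have [t2 [u2 [x2 b2 e2 o2]]] := gC 2 (EVar 0) u1 x (o1 0 isT).
have e3 : u2 1 = f x by rewrite o2.
eexists.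
  eexists; first exact: ExecSeq (ExecSeq x1 x2) (ExecAssign _ _ _).
  by rewrite /update /= e2 e3.
have s0 : s 0 = x by [].
by rewrite /= e2 e3 o1 // s0; lia.
Qed.

Lemma ptime_const d : ptime (fun=> d).
Proof.
by elim: d => [|a aP b bP]; [exact: ptime_leaf|exact: ptime_pair].
Qed.

Lemma ptime_dtest f g : ptime f -> ptime g -> ptime (fun x => dtest (f x) (g x)).
Proof.
move=> fP gP; have := ptime_pair fP gP.
apply: (@ptime_comp (fun z => dtest (dleft z) (dright z))).
apply: (@ptime_assign (EEq (ELeft (EVar 0)) (ERight (EVar 0)))).
apply: (@pbounded_le _ (fun x => 3 + (dsize x + dsize x + dsize x + dsize x))).
  move=> x; have := dsize_dleft x; have := dsize_dright x.
  by rewrite /= /update /= -/(dleft x) -/(dright x); case: ifP => _ /=; lia.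
by pbounded_auto.
Qed.

Lemma ptime_if f g h : ptime f -> ptime g -> ptime h ->
  ptime (fun x => if f x is Leaf then h x else g x).
Proof.
move=> fP gP hP.
have fS := ptime_dsize fP; have gS := ptime_dsize gP; have hS := ptime_dsize hP.
have [cf [Tf [TfP fC]]] := ptime_call fP.
have [cg [Tg [TgP gC]]] := ptime_call gP.
have [ch [Th [ThP hC]]] := ptime_call hP.
exists (Seq (Seq (call 1 cf (EVar 0))
  (If (EVar 1) (call 1 cg (EVar 0)) (call 1 ch (EVar 0)))) (Assign 0 (EVar 1))).
exists (fun x => dsize x + Tf x + (dsize (f x) + (dsize x + Tg x + Th x))
  + (dsize (g x) + dsize (h x))).
split.
  by pbounded_auto.
move=> x; pose s := update (fun=> Leaf) 0 x.
have [t1 [u1 [x1 b1 e1 o1]]] := fC 1 (EVar 0) s x erefl.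
have s0 : s 0 = x by [].
case fx: (f x) => [|l r].
  have [t2 [u2 [x2 b2 e2 o2]]] := hC 1 (EVar 0) u1 x (o1 0 isT).
  eexists.
    eexists.
      apply: ExecSeq (ExecSeq x1 (ExecIfFalse _ _ x2)) (ExecAssign _ _ _).
      by rewrite /= e1.
    by rewrite /update /= e2.
  by rewrite /= e2 e1 (o1 0 isT) s0 fx /=; lia.
have [t2 [u2 [x2 b2 e2 o2]]] := gC 1 (EVar 0) u1 x (o1 0 isT).
eexists.
  eexists.
    apply: ExecSeq (ExecSeq x1 (ExecIfTrue _ _ x2)) (ExecAssign _ _ _).
    by rewrite /= e1 fx.
  by rewrite /update /= e2.
by rewrite /= e2 e1 (o1 0 isT) s0 fx /=; lia.
Qed.

(** The step receives the whole remaining list, head and tail, so that it can also read off the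
    position of the current element. *)
Fixpoint sfold (F : data -> data -> data) (w acc : data) : data :=
  if w is Node _ w' then sfold F w' (F w acc) else acc.

(* The last hypothesis keeps the accumulator polynomial: each step adds an
   amount to it that does not depend on it. *)
Lemma ptime_sfold l i (F : data -> data -> data -> data) q :
  ptime l -> ptime i ->
  ptime (fun z => F (dleft (dleft z)) (dright (dleft z)) (dright z)) ->
  pbounded q ->
  (forall x w acc, dsize (F x w acc) <= dsize acc + q (Node x w)) ->
  ptime (fun x => sfold (F x) (l x) (i x)).
Proof.
move=> lP iP FP qP Fq; have lS := ptime_dsize lP; have iS := ptime_dsize iP.
have [cl [Tl [TlP lC]]] := ptime_call lP.
have [ci [Ti [TiP iC]]] := ptime_call iP.
have [cF [TF [[a [b TFP]] FC]]] := ptime_call FP.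
have {qP Fq} [a' [b' Fq]] : exists a' b', forall x w acc,
    dsize (F x w acc) <= dsize acc + a' * (dsize x + dsize w).+1 ^ b'.
  have [a' [b' qB]] := qP; exists a', b' => x w acc.
  by apply: leq_trans (Fq x w acc) _; rewrite leq_add2l; apply: qB.
(* Variable 0 keeps [x], 1 the rest of the list and 2 the accumulator; the step works from 3
   upwards. *)
pose body := Seq (Seq
  (call 3 cF (ENode (ENode (EVar 0) (EVar 1)) (EVar 2)))
  (Assign 2 (EVar 3))) (Assign 1 (ERight (EVar 1))).
(* [Q] bounds the growth in one step, as no suffix exceeds [l x]; [B] bounds the accumulator
   throughout; [K] bounds the time of a round, its last summand paying for the step and the factor
   10 for the expressions around it. *)
pose Q x := a' * (dsize x + dsize (l x)).+1 ^ b'.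
pose B x := dsize (i x) + dsize (l x) * Q x.
pose K x := 10 * (dsize x + dsize (l x) + B x).+2
  + a * (dsize x + dsize (l x) + B x).+2 ^ b.
(* [dsize w] exceeds the number of rounds left, so [dsize (u 2) + dsize w * Q x] never increases: it
   is a potential that keeps the accumulator below [B x]. *)
have loop x w (u : store) : u 0 = x -> u 1 = w ->
    dsize w <= dsize (l x) -> dsize (u 2) + dsize w * Q x <= B x ->
    exists t u', [/\ exec (While (EVar 1) body) u t u', t <= dsize w * K x,
      u' 2 = sfold (F x) w (u 2) & dsize (u' 2) <= B x].
  elim: w u => [|w1 _ w IH] u u0 u1 wl uB.
    exists (cost u (EVar 1)), u; split=> //.
    - by apply: ExecWhileFalse; rewrite /= u1.
    - by rewrite /= u1 /K; lia.
    - lia.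
  have [t1 [v1 [x1 b1 e1 o1]]] := FC 3 (ENode (ENode (EVar 0) (EVar 1)) (EVar 2))
    u (Node (Node x (Node w1 w)) (u 2)) (ltac:(by rewrite /= u0 u1)).
  pose v2 := update v1 2 (v1 3).
  pose v3 := update v2 1 (eval v2 (ERight (EVar 1))).
  have sF := Fq x (Node w1 w) (u 2).
  have QF : a' * (dsize x + dsize (Node w1 w)).+1 ^ b' <= Q x.
    by rewrite /Q; apply: leq_mul => //; apply: leq_expn2l; lia.
  have v32 : v3 2 = F x (Node w1 w) (u 2) by rewrite /v3 /v2 /update /= e1.
  have wB : dsize (v3 2) + dsize w * Q x <= B x.
    apply: leq_trans uB; rewrite v32 /= mulSn mulnDl; lia.
  have [||||t [v [x4 b4 e4 s4]]] := IH v3.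
  - by rewrite /v3 /v2 /update /= o1 // u0.
  - by rewrite /v3 /v2 /update /= (o1 1 isT) u1.
  - by move: wl => /=; lia.
  - exact: wB.
  have x5 : exec body u (cost u (ENode (ENode (EVar 0) (EVar 1)) (EVar 2)) + t1
      + cost v1 (EVar 3) + cost v2 (ERight (EVar 1))) v3.
    apply: ExecSeq (ExecSeq x1 (ExecAssign _ _ _)) _.
    exact: ExecAssign.
  eexists; exists v; split.
  - by apply: ExecWhileTrue x5 x4; rewrite /= u1.
  - rewrite /= /v2 /update /= e1 (o1 1 isT) u0 u1 /=.
    have T1 : t1 <= a * (dsize x + dsize (l x) + B x).+2 ^ b.
      apply: leq_trans b1 _; apply: leq_trans (TFP _) _.
      apply: leq_mul => //; apply: leq_expn2l => /=.
      by move: uB wl => /=; lia.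
    have : 10 * (dsize x + dsize (l x) + B x).+2 + t1 <= K x.
      by rewrite /K leq_add2l.
    have : dsize (v3 2) <= B x by lia.
    move: wl uB b4; rewrite v32 /= !mulSn !mulnDl.
    by lia.
  - by rewrite e4 v32.
  - by [].
exists (Seq (Seq (Seq (call 1 cl (EVar 0)) (call 2 ci (EVar 0)))
  (While (EVar 1) body)) (Assign 0 (EVar 2))).
exists (fun x => dsize x + Tl x + (dsize x + Ti x) + dsize (l x) * K x + B x).
split.
  have QP : pbounded Q.
    apply: pboundedM (pbounded_const _) (pboundedX _ _).
    by apply: (@pbounded_le _ (fun x => 1 + (dsize x + dsize (l x)))) => //;
      pbounded_auto.
  have BP : pbounded B by rewrite /B; pbounded_auto.
  have NP : pbounded (fun x => (dsize x + dsize (l x) + B x).+2).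
    by apply: (@pbounded_le _ (fun x => 2 + (dsize x + dsize (l x) + B x))) => //;
      pbounded_auto.
  have KP : pbounded K by rewrite /K; pbounded_auto.
  by pbounded_auto.
move=> x; pose s := update (fun=> Leaf) 0 x.
have [t1 [u1 [x1 b1 e1 o1]]] := lC 1 (EVar 0) s x erefl.
have [t2 [u2 [x2 b2 e2 o2]]] := iC 2 (EVar 0) u1 x (o1 0 isT).
have [||||t3 [u3 [x3 b3 e3 s3]]] := loop x (l x) u2.
- by rewrite o2 // o1.
- by rewrite o2.
- by [].
- by rewrite e2.
eexists.
  eexists; first exact: ExecSeq (ExecSeq (ExecSeq x1 x2) x3) (ExecAssign _ _ _).
  by rewrite /update /= e3 e2.
have s0 : s 0 = x by [].
by rewrite /= o1 // s0; lia.
Qed.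

(** * List comprehensions in polynomial time *)

Definition revapp (u v : data) : data :=
  sfold (fun w acc => Node (dleft w) acc) u v.

Lemma dsize_revapp u v : dsize (revapp u v) < dsize u + dsize v.
Proof.
rewrite /revapp; elim: u v => [|a _ u IH] v //=.
by apply: leq_trans (IH _) _ => /=; lia.
Qed.

Lemma ptime_revapp f g :
  ptime f -> ptime g -> ptime (fun x => revapp (f x) (g x)).
Proof.
move=> fP gP.
apply: (@ptime_sfold f g (fun _ w acc => Node (dleft w) acc) dsize) => //.
- apply: ptime_pair; last exact: ptime_dright ptime_id.
  by do !apply: ptime_dleft || apply: ptime_dright; apply: ptime_id.
- exact: pbounded_dsize.
- by move=> x w acc; have := dsize_dleft w; rewrite /=; lia.
Qed.

Definition flatmap (g : data -> data) (l i : data) : data :=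
  sfold (fun w acc => revapp (g w) acc) l i.

Lemma ptime_flatmap (g : data -> data -> data) l i :
  ptime (fun z => g (dleft z) (dright z)) -> ptime l -> ptime i ->
  ptime (fun x => flatmap (g x) (l x) (i x)).
Proof.
move=> gP lP iP.
apply: (@ptime_sfold l i (fun x w acc => revapp (g x w) acc)
  (fun z => dsize (g (dleft z) (dright z)))) => //.
- apply: ptime_revapp; last exact: ptime_dright ptime_id.
  exact: (ptime_comp gP (ptime_dleft ptime_id)).
- exact: ptime_dsize gP.
- by move=> x w acc; apply: leq_trans (ltnW (dsize_revapp _ _)) _; rewrite addnC.
Qed.

(** * Trees read as lists *)

Lemma data_eqP : Equality.axiom data_eq.
Proof.
move=> d e; apply: (iffP idP) => [|<-].
  by elim: d e => [|a IHa b IHb] [|a' b'] //= /andP[/IHa-> /IHb->].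
by elim: d {e} => //= a -> b ->.
Qed.

HB.instance Definition _ := hasDecEq.Build data data_eqP.

(* A bijection from [data] to [seq data]. *)
Fixpoint items (d : data) : seq data :=
  if d is Node a b then a :: items b else [::].

Lemma items_code_seq A (f : A -> data) s : items (code_seq f s) = map f s.
Proof. by elim: s => //= a s ->. Qed.

Lemma items_inj d e : items d = items e -> d = e.
Proof. by elim: d e => [|a _ b IH] [|a' b'] //= [-> /IH ->]. Qed.

Lemma items_code_nat n : items (code_nat n) = nseq n Leaf.
Proof. by elim: n => //= n ->. Qed.

Lemma code_nat_inj : injective code_nat.
Proof. by elim=> [|n IH] [|m] //= [/IH->]. Qed.

Lemma dsize_code_nat n : dsize (code_nat n) = n.*2.+1.
Proof. by elim: n => //= n ->; lia. Qed.

Lemma items_revapp u v : items (revapp u v) = catrev (items u) (items v).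
Proof. by rewrite /revapp; elim: u v => [|a _ u IH] v //=; rewrite IH. Qed.

(** All items of a unary number are [Leaf], so the reversal is invisible and concatenation is
    addition. *)
Lemma revapp_code_nat n m :
  revapp (code_nat n) (code_nat m) = code_nat (n + m).
Proof.
by apply: items_inj; rewrite items_revapp !items_code_nat catrevE rev_nseq nseqD.
Qed.

(** These are the values on which [sfold] calls its step, in order. *)
Fixpoint suffixes (d : data) : seq data :=
  if d is Node _ b then d :: suffixes b else [::].

Lemma items_flatmap g l i :
  perm_eq (items (flatmap g l i))
    (flatten [seq items (g w) | w <- suffixes l] ++ items i).
Proof.
rewrite /flatmap; elim: l i => [|a _ l IH] i //=.
apply: perm_trans (IH _) _; rewrite items_revapp catrevE catA.
by rewrite perm_cat2r perm_catC perm_cat2r perm_rev.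
Qed.

Lemma rev_iotaS n : rev (iota 0 n.+1) = n :: rev (iota 0 n).
Proof. by rewrite -addn1 iotaD rev_cat. Qed.

(* The index of an element is the length of the list behind it. *)
Fixpoint ranked A (s : seq A) : seq (nat * A) :=
  if s is a :: s' then (size s', a) :: ranked s' else [::].

Lemma ranked1 A (s : seq A) : map fst (ranked s) = rev (iota 0 (size s)).
Proof. by elim: s => // a s IH; rewrite [size _]/= rev_iotaS -IH. Qed.

Lemma ranked2 A (s : seq A) : map snd (ranked s) = s.
Proof. by elim: s => //= a s ->. Qed.

Lemma map_suffixes A B (f : A -> data) (g : data -> B) (G : nat * A -> B) s :
  (forall a s', g (Node (f a) (code_seq f s')) = G (size s', a)) ->
  map g (suffixes (code_seq f s)) = map G (ranked s).
Proof. by move=> gG; elim: s => //= a s ->; rewrite gG. Qed.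

(** The tails met along a unary number are exactly the smaller numbers, so a loop over [n] runs
    through all [m < n]. *)
Lemma map_suffixes_nat B (g : data -> B) n :
  map g (suffixes (code_nat n)) =
  [seq g (Node Leaf (code_nat m)) | m <- rev (iota 0 n)].
Proof. by elim: n => // n IH; rewrite rev_iotaS map_cons -IH. Qed.

Definition listmap (g : data -> data) := flatmap (fun w => Node (g w) Leaf).

Lemma items_listmap g l i :
  perm_eq (items (listmap g l i)) (map g (suffixes l) ++ items i).
Proof.
apply: perm_trans (items_flatmap _ _ _) _.
by rewrite (map_comp (fun a => [:: a]) g) flatten_seq1.
Qed.

Lemma items_listmap_nat (g : data -> data) n i :
  perm_eq (items (listmap g (code_nat n) i))
    ([seq g (Node Leaf (code_nat m)) | m <- iota 0 n] ++ items i).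
Proof.
apply: perm_trans (items_listmap _ _ _) _.
by rewrite perm_cat2r map_suffixes_nat perm_map // perm_rev.
Qed.

Lemma items_listmap_seq A (f : A -> data) (g : data -> data)
    (G : nat * A -> data) s i :
  (forall a s', g (Node (f a) (code_seq f s')) = G (size s', a)) ->
  perm_eq (items (listmap g (code_seq f s) i)) (map G (ranked s) ++ items i).
Proof.
by move=> gG; apply: perm_trans (items_listmap _ _ _) _; rewrite (map_suffixes _ gG).
Qed.

Lemma ptime_listmap (g : data -> data -> data) l i :
  ptime (fun z => g (dleft z) (dright z)) -> ptime l -> ptime i ->
  ptime (fun x => listmap (g x) (l x) (i x)).
Proof.
move=> gP; apply: (@ptime_flatmap (fun x w => Node (g x w) Leaf)).
exact: ptime_pair gP ptime_leaf.
Qed.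

Lemma items_listmap_const c l :
  items (listmap (fun=> c) l Leaf) = nseq (size (items l)) c.
Proof.
have := items_listmap (fun=> c) l Leaf; rewrite cats0 => cE.
have sE : size (items (listmap (fun=> c) l Leaf)) = size (items l).
  rewrite (perm_size cE) size_map {cE}.
  by elim: l => //= a _ l ->.
rewrite -sE; apply/all_pred1P; rewrite (perm_all _ cE).
by apply/allP => _ /mapP[? _ ->] /=.
Qed.

Definition len (d : data) : data := listmap (fun=> Leaf) d Leaf.

Lemma len_code_seq A (f : A -> data) s : len (code_seq f s) = code_nat (size s).
Proof.
apply: items_inj.
by rewrite items_listmap_const items_code_seq items_code_nat size_map.
Qed.

Lemma ptime_len f : ptime f -> ptime (fun x => len (f x)).
Proof.
move=> fP; apply: (@ptime_listmap (fun _ _ => Leaf)) => //; exact: ptime_leaf.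
Qed.

(** The positions are permuted, which works for any [f]. This turns a list of codes known up to
    order into the codes of a genuine list. *)
Lemma perm_map_preim (T U : eqType) (f : T -> U) s t :
  perm_eq t (map f s) -> exists2 s', perm_eq s' s & t = map f s'.
Proof.
case: s => [|x0 s].
  by move=> /perm_nilP ->; exists [::].
set s0 := x0 :: s => /(perm_iotaP (f x0))[Is IsP ->].
exists (map (nth x0 s0) Is).
  by apply/(perm_iotaP x0); exists Is => //; move: IsP; rewrite size_map.
rewrite -map_comp; apply/eq_in_map => i.
rewrite (perm_mem IsP) mem_iota size_map => /= iX.
by rewrite -[f x0 :: _]/(map f s0) (nth_map x0).
Qed.

Lemma codes_setP (A : finType) (f : A -> data) (X : {set A}) d :
  codes_set f X d <-> perm_eq (items d) (map f (enum X)).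
Proof.
split=> [[s sX ->]|/perm_map_preim[s sX dE]].
  by rewrite items_code_seq perm_map.
by exists s => //; apply: items_inj; rewrite items_code_seq.
Qed.

(** * The reduction as a program *)

Definition dif (d a b : data) : data := if d is Leaf then b else a.

Lemma ptime_dif f g h : ptime f -> ptime g -> ptime h ->
  ptime (fun x => dif (f x) (g x) (h x)).
Proof. exact: ptime_if. Qed.

Ltac ptime_step :=
  first [ assumption | exact: ptime_id | exact: ptime_const
  | apply: ptime_dleft | apply: ptime_dright | apply: ptime_pair
  | apply: ptime_dtest | apply: ptime_dif | apply: ptime_revapp
  | apply: ptime_len | apply: ptime_listmap | apply: ptime_flatmap ]; cbv beta.

Ltac ptime_auto := repeat ptime_step.

Definition in_size (x : data) : data := dleft (dleft x).
Definition in_edges (x : data) : data := dleft (dright (dleft x)).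
Definition in_pairs (x : data) : data := dright (dright (dleft x)).
Definition in_budget (x : data) : data := dright x.
Definition in_npairs (x : data) : data := len (in_pairs x).

(** [Node Leaf (in_budget x)] is p + 1 in unary, and [len (dright w)] is the index of the pair. *)
Definition out_copies (x : data) : data :=
  flatmap (fun w => listmap (fun=> Node (len (dright w)) (dleft w))
    (Node Leaf (in_budget x)) Leaf) (in_pairs x) Leaf.

Lemma ptime_out_copies : ptime out_copies.
Proof.
rewrite /out_copies /in_budget /in_pairs.
by ptime_auto.
Qed.

(** Vertices are numbered in blocks: original ones, sources, sinks, middle vertices on the way in,
    middle vertices on the way out. The sources start at [in_size], the last three blocks at the
    offsets defined here. *)
Definition out_sinks (x : data) : data := revapp (in_size x) (in_npairs x).
Definition out_in_mids (x : data) : data := revapp (out_sinks x) (in_npairs x).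
Definition out_out_mids (x : data) : data :=
  revapp (out_in_mids x) (len (out_copies x)).
Definition out_size (x : data) : data :=
  revapp (out_out_mids x) (len (out_copies x)).

(** Here [dleft w] is a copy, made of the index of its pair and the pair itself; [len (dright w)] is
    the number of the copy. *)
Definition out_edges (x : data) : data :=
  listmap (fun w => Node (revapp (in_size x) (dleft (dleft w)))
      (revapp (out_in_mids x) (len (dright w)))) (out_copies x)
  (listmap (fun w => Node (revapp (out_in_mids x) (len (dright w)))
      (dleft (dright (dleft w)))) (out_copies x)
  (listmap (fun w => Node (dright (dright (dleft w)))
      (revapp (out_out_mids x) (len (dright w)))) (out_copies x)
  (listmap (fun w => Node (revapp (out_out_mids x) (len (dright w)))
      (revapp (out_sinks x) (dleft (dleft w)))) (out_copies x)
  (in_edges x)))).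

Definition out_labels (x : data) : data :=
  listmap (fun w => Node (revapp (in_size x) (dright w)) (dright w))
    (revapp (in_npairs x) (in_npairs x)) Leaf.

Definition out_order (x : data) : data :=
  listmap (fun w => Node (dright w) (dright w))
    (revapp (in_npairs x) (in_npairs x))
  (flatmap (fun w => flatmap (fun w' =>
      dif (dtest (dright w) (dright w')) Leaf
        (Node (Node (revapp (in_npairs x) (dright w)) (dright w')) Leaf))
    (in_npairs x) Leaf) (in_npairs x) Leaf).

Definition reduction (x : data) : data :=
  Node (Node (Node (out_size x) (out_edges x))
    (Node (out_labels x)
      (Node (revapp (in_npairs x) (in_npairs x)) (out_order x)))) (in_budget x).

Lemma ptime_reduction : ptime reduction.
Proof.
have copiesP f : ptime f -> ptime (fun x => out_copies (f x)).
  exact: ptime_comp ptime_out_copies.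
rewrite /reduction /out_edges /out_labels /out_order /out_size /out_out_mids
  /out_in_mids /out_sinks /in_budget /in_npairs /in_size /in_edges /in_pairs.
by repeat first [ptime_step | apply: copiesP].
Qed.

(** * The lattice cut instance *)

Lemma ranked_ltn (A : eqType) (s : seq A) q : q \in ranked s -> q.1 < size s.
Proof. by move=> /(map_f fst); rewrite ranked1 mem_rev mem_iota. Qed.

Lemma uniq_ranked1 A (s : seq A) : uniq (map fst (ranked s)).
Proof. by rewrite ranked1 rev_uniq iota_uniq. Qed.

Lemma ranked_inj (A : eqType) (s : seq A) : {in ranked s &, injective fst}.
Proof.
elim: s => //= a s IH q q'; rewrite !inE.
case/predU1P => [->|qs]; case/predU1P => [->|qs'] //=; last exact: IH.
  by move=> e; have := ranked_ltn qs'; rewrite -e ltnn.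
by move=> e; have := ranked_ltn qs; rewrite e ltnn.
Qed.

Lemma uniq_ranked (A : eqType) (s : seq A) : uniq (ranked s).
Proof. exact: map_uniq (uniq_ranked1 s). Qed.

Lemma reachable_closed (V : finType) (E : {set V * V}) (R : V -> Prop) x y :
  (forall e, e \in E -> R e.1 -> R e.2) -> R x -> reachable E x y -> R y.
Proof.
move=> RE Rx /connectP[s + ->]; elim: s x Rx => //= z s IH x Rx /andP[xz].
by apply: IH; apply: (RE _ xz).
Qed.

Lemma reachable1 (V : finType) (E : {set V * V}) x y :
  (x, y) \in E -> reachable E x y.
Proof. by move=> xy; apply: connect1. Qed.

(** Otherwise each [m] in [s] loses one of its two edges to [S], and distinct [m] lose distinct
    edges, so [S] has at least [size s] elements. *)
Lemma reachable_two_steps (V : finType) (E S : {set V * V}) x y (s : seq V) :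
  uniq s -> x \notin s -> #|S| < size s ->
  (forall m, m \in s -> (x, m) \in E /\ (m, y) \in E) ->
  reachable (E :\: S) x y.
Proof.
move=> us xs Ss sE; apply: contraTT Ss => nxy; rewrite -leqNgt cardE.
(* This map recovers the middle vertex from a cut edge. As [x] is not in [s], an edge [(m, y)] is
   never mistaken for one leaving [x]. *)
rewrite -(size_map (fun e => if e.1 == x then e.2 else e.1)).
apply: uniq_leq_size => // m ms; have [xm my] := sE m ms.
have [xmS|xmS] := boolP ((x, m) \in S).
  by apply/mapP; exists (x, m); rewrite ?mem_enum //= eqxx.
have [myS|myS] := boolP ((m, y) \in S).
  apply/mapP; exists (m, y); rewrite ?mem_enum //=.
  by case: eqP => // mx; rewrite -mx ms in xs.
case/negP: nxy; apply: (@connect_trans _ _ m); apply: reachable1.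
  by rewrite inE xmS.
by rewrite inE myS.
Qed.

(* The crown: the minimal elements k + j and the maximal elements i, for
   i, j < k, with k + j below i unless i = j. *)
Definition crown (k : nat) : Type := 'I_(k + k).

HB.instance Definition _ k := Finite.on (crown k).

Definition crown_le k (a b : crown k) : bool :=
  (a == b) || [&& k <= (a : 'I_ _), (b : 'I_ _) < k
                & (a : 'I_ _) != k + (b : 'I_ _) :> nat].

Lemma crown_le_refl k : reflexive (@crown_le k).
Proof. by move=> a; rewrite /crown_le eqxx. Qed.

Lemma crown_le_anti k : antisymmetric (@crown_le k).
Proof.
move=> a b /andP[]; rewrite /crown_le.
by case/predU1P => // /and3P[? ? _]; case/predU1P => // /and3P[? ? _]; lia.
Qed.

(** The order has height two, so two strict comparisons never compose. *)
Lemma crown_le_trans k : transitive (@crown_le k).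
Proof.
move=> b a c; rewrite /crown_le.
case/predU1P => [-> //|/and3P[? ? ab]]; case/predU1P => [<-|/and3P[? ? _]].
  by apply/orP; right; apply/and3P.
by lia.
Qed.

HB.instance Definition _ k := Order.Le_isPOrder.Build (Order.Disp tt tt) (crown k)
  (@crown_le_refl k) (@crown_le_anti k) (@crown_le_trans k).

Definition code_edge (e : nat * nat) : data := Node (code_nat e.1) (code_nat e.2).

Lemma code_elt_ord n (i : 'I_n) : code_elt i = code_nat i.
Proof. by rewrite /code_elt enum_rank_ord. Qed.

Lemma perm_code_edges a b (X : {set 'I_a * 'I_b}) (s : seq (nat * nat)) :
  uniq s -> (forall e, e \in s -> e.1 < a /\ e.2 < b) ->
  (forall e, (e \in X) = ((val e.1, val e.2) \in s)) ->
  perm_eq (map code_edge s) (map (@code_pair _ _) (enum X)).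
Proof.
move=> us sab Xs.
have -> : map (@code_pair _ _) (enum X)
    = map code_edge [seq (val e.1, val e.2) | e <- enum X].
  by rewrite -map_comp; apply: eq_map => e; rewrite /code_pair !code_elt_ord.
apply: perm_map; apply: uniq_perm => //.
  by rewrite map_inj_uniq ?enum_uniq // => -[? ?] [? ?] [/val_inj-> /val_inj->].
move=> [i j]; apply/idP/mapP => [ij|[e]]; last by rewrite mem_enum Xs => ? ->.
have [/= ia jb] := sab _ ij.
by exists (Ordinal ia, Ordinal jb); rewrite ?mem_enum ?Xs.
Qed.

(** * The graph of the lattice cut instance *)

Section Gadget.

Variables (V : finType) (E : {set V * V}) (prs : seq (V * V)) (p : nat).
Variable Q : seq (nat * (V * V)).

Let n := #|V|.
Let k := size prs.
Let K := size Q.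
Let N := n + k + k + K + K.

Definition rk (v : V) : nat := enum_rank v.

(** An element of [ranked Q] is [(h, (i, (s, t)))]: the copy number [h] names the two middle
    vertices, [i] the source and the sink. *)
Definition gadget_edges : seq (nat * nat) :=
  [seq (n + q.2.1, n + k + k + q.1) | q <- ranked Q] ++
 ([seq (n + k + k + q.1, rk q.2.2.1) | q <- ranked Q] ++
 ([seq (rk q.2.2.2, n + k + k + K + q.1) | q <- ranked Q] ++
 ([seq (n + k + k + K + q.1, n + k + q.2.1) | q <- ranked Q] ++
  [seq (rk e.1, rk e.2) | e <- enum E]))).

Definition gadget_edge_set : {set 'I_N * 'I_N} :=
  [set e | (val e.1, val e.2) \in gadget_edges].

Lemma rk_lt v : rk v < n.
Proof. exact: ltn_ord. Qed.

Lemma rk_inj : injective rk.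
Proof. by move=> u v /val_inj/enum_rank_inj. Qed.

Definition gadget_terminals : {set 'I_N} :=
  [set v : 'I_N | n <= v < n + (k + k)].

Lemma gadget_label_proof (x : {v : 'I_N | v \in gadget_terminals}) :
  val x - n < k + k.
Proof. by case: x => v /=; rewrite inE; lia. Qed.

Definition gadget_label (x : {v : 'I_N | v \in gadget_terminals}) : crown k :=
  Ordinal (gadget_label_proof x).

Lemma terminal_lt i : i < k + k -> n + i < N.
Proof. by rewrite /N; lia. Qed.

Lemma terminal_in i (ik : i < k + k) : Ordinal (terminal_lt ik) \in gadget_terminals.
Proof. by rewrite inE /=; lia. Qed.

Definition terminal i (ik : i < k + k) : {v : 'I_N | v \in gadget_terminals} :=
  Sub (Ordinal (terminal_lt ik)) (terminal_in ik).

Lemma gadget_label_surj (a : crown k) : exists x, gadget_label x = a.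
Proof.
case: a => i ik; exists (terminal ik); apply: val_inj => /=; lia.
Qed.

Definition gadget : lattice_instance :=
  LatticeInstance gadget_edge_set gadget_label_surj.

Lemma emb_lt v : rk v < N.
Proof. by have := rk_lt v; rewrite /N; lia. Qed.

Definition emb v : 'I_N := Ordinal (emb_lt v).

Lemma perm_terminals :
  perm_eq (map val (enum gadget_terminals)) (iota n (k + k)).
Proof.
apply: uniq_perm; rewrite ?iota_uniq ?(map_inj_uniq val_inj) ?enum_uniq //.
move=> i; rewrite mem_iota; apply/mapP/idP => [[v]|ik].
  by rewrite mem_enum inE => ? ->.
have ik' : i - n < k + k by lia.
exists (Ordinal (terminal_lt ik')); last by rewrite /=; lia.
by rewrite mem_enum terminal_in.
Qed.

Lemma card_gadget_terminals : #|gadget_terminals| = k + k.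
Proof. by rewrite cardE -(size_map val) (perm_size perm_terminals) size_iota. Qed.

Hypothesis QP : perm_eq Q (flatten [seq nseq p.+1 q | q <- ranked prs]).

Lemma copies_ranked (q : nat * (nat * (V * V))) : q \in ranked Q -> q.2 \in ranked prs.
Proof.
move=> qQ; have : q.2 \in Q by rewrite -[Q in X in _ \in X]ranked2 map_f.
by rewrite (perm_mem QP) => /flatten_mapP[q' q's]; rewrite mem_nseq /= => /eqP->.
Qed.

Lemma copies_bounds (q : nat * (nat * (V * V))) : q \in ranked Q ->
  [/\ q.1 < K, q.2.1 < k, rk q.2.2.1 < n & rk q.2.2.2 < n].
Proof.
by move=> qQ; split; rewrite ?rk_lt //; [exact: ranked_ltn|
  exact: ranked_ltn (copies_ranked qQ)].
Qed.

Lemma many_copies q : q \in ranked prs ->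
  p < size [seq r.1 | r <- ranked Q & r.2 == q].
Proof.
move=> qs; rewrite size_map size_filter.
rewrite -(count_map snd (pred1 q)) ranked2 (permP QP).
elim: (ranked prs) qs => //= r s IH; rewrite inE count_cat count_nseq /=.
case/predU1P => [->|/IH]; rewrite ?eqxx; lia.
Qed.

Variant gadget_edge_spec : nat -> nat -> Prop :=
  | SourceMid (q : nat * (nat * (V * V))) of q \in ranked Q :
      gadget_edge_spec (n + q.2.1) (n + k + k + q.1)
  | MidIn (q : nat * (nat * (V * V))) of q \in ranked Q :
      gadget_edge_spec (n + k + k + q.1) (rk q.2.2.1)
  | OutMid (q : nat * (nat * (V * V))) of q \in ranked Q :
      gadget_edge_spec (rk q.2.2.2) (n + k + k + K + q.1)
  | MidSink (q : nat * (nat * (V * V))) of q \in ranked Q :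
      gadget_edge_spec (n + k + k + K + q.1) (n + k + q.2.1)
  | Original e of e \in E : gadget_edge_spec (rk e.1) (rk e.2).

Lemma gadget_edgesP i j : reflect (gadget_edge_spec i j) ((i, j) \in gadget_edges).
Proof.
apply: (iffP idP).
  rewrite !mem_cat => /or4P[||| /orP[]] /mapP[q + [-> ->]].
  - exact: SourceMid.
  - exact: MidIn.
  - exact: OutMid.
  - exact: MidSink.
  - by rewrite mem_enum; apply: Original.
rewrite !mem_cat; case=> [q|q|q|q|e] qQ.
- by apply/orP; left; apply/mapP; exists q.
- by apply/orP; right; apply/orP; left; apply/mapP; exists q.
- by do 2![apply/orP; right]; apply/orP; left; apply/mapP; exists q.
- by do 3![apply/orP; right]; apply/orP; left; apply/mapP; exists q.
- by do 4![apply/orP; right]; apply/mapP; exists e; rewrite ?mem_enum.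
Qed.

Lemma gadget_edges_lt e : e \in gadget_edges -> e.1 < N /\ e.2 < N.
Proof.
rewrite /N; case: e => i j /gadget_edgesP[q|q|q|q|e] qQ /=;
  try have [? ? ? ?] := copies_bounds qQ.
- by lia.
- by lia.
- by lia.
- by lia.
- by have := rk_lt e.1; have := rk_lt e.2; lia.
Qed.

(** An encoding must list the edges without repetition. Within a new family the middle vertex
    determines the copy; edges of different families have an endpoint in different blocks of
    numbers. *)
Lemma uniq_gadget_edges : uniq gadget_edges.
Proof.
have uQ (f : nat * (nat * (V * V)) -> nat * nat) :
    {in ranked Q &, forall q r : nat * (nat * (V * V)), f q = f r -> q.1 = r.1} ->
    uniq (map f (ranked Q)).
  move=> fI; rewrite map_inj_in_uniq ?uniq_ranked // => q r qQ rQ /(fI _ _ qQ rQ).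
  exact: (ranked_inj qQ rQ).
rewrite /gadget_edges !cat_uniq; do !(apply/andP; split);
  try (apply: uQ => q r _ _ [? ?]; lia);
  last by rewrite map_inj_uniq ?enum_uniq // => -[? ?] [? ?] [/rk_inj-> /rk_inj->].
all: apply/hasPn => e; rewrite ?mem_cat => eH; apply/negP.
all: case/mapP => q /copies_bounds[? ? ? ?] qE.
all: move: eH; rewrite {}qE; do ?case/orP.
all: case/mapP => r rQ [? ?]; try (have [? ? ? ?] := copies_bounds rQ).
all: try lia.
all: by match goal with H : _ = rk ?u, H' : _ = rk ?v |- _ =>
  have := rk_lt u; have := rk_lt v end; lia.
Qed.

Lemma emb_edge u v : (u, v) \in E -> (emb u, emb v) \in gadget_edge_set.
Proof. by move=> uv; rewrite inE; apply/gadget_edgesP; exact: (Original uv). Qed.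

Lemma reachable_copies (S : {set 'I_N * 'I_N}) (x y : 'I_N) c
    (q : nat * (V * V)) :
  #|S| <= p -> q \in ranked prs -> n + k + k <= c <= n + k + k + K ->
  ~~ (c <= x < c + K) ->
  (forall (m : 'I_N) (h : nat), (h, q) \in ranked Q -> m = c + h :> nat ->
     (x, m) \in gadget_edge_set /\ (m, y) \in gadget_edge_set) ->
  reachable (gadget_edge_set :\: S) x y.
Proof.
move=> Sp qs cb xc xmy.
set H := [seq r.1 | r <- ranked Q & r.2 == q].
have HP h : h \in H -> (h, q) \in ranked Q.
  by case/mapP => -[h' r]; rewrite mem_filter /= => /andP[/eqP-> ?] ->.
(* [c + h] is below [N], so the default [x] of [insubd] never shows up. *)
have mE h : h \in H -> val (insubd x (c + h)) = c + h.
  by move=> /HP/ranked_ltn /= hK; rewrite val_insubd ifT // /N -/K; lia.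
apply: (@reachable_two_steps _ _ _ _ _ [seq insubd x (c + h) | h <- H]).
- rewrite map_inj_in_uniq.
    have := uniq_ranked1 Q; apply: subseq_uniq.
    by apply: map_subseq; apply: filter_subseq.
  by move=> h h' /mE hE /mE hE' /(congr1 val); rewrite hE hE'; lia.
- apply: contra xc => /mapP[h hH ->]; rewrite mE //.
  by have := ranked_ltn (HP _ hH); rewrite -/K /=; lia.
- by rewrite size_map; apply: leq_ltn_trans Sp (many_copies qs).
- by move=> m /mapP[h hH ->]; apply: xmy (HP _ hH) _; rewrite mE.
Qed.

(** A path of a pair that avoids [S'] would extend, through copies spared by [S], to a path from
    source [i] to sink [i], but the crown does not put [k + i] below [i]. *)
Lemma gadget_back (S : {set 'I_N * 'I_N}) :
  is_lattice_cut (I := gadget) S -> #|S| <= p ->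
  let S' := [set e in E | (emb e.1, emb e.2) \in S] in
  is_multicut (I := MulticutInstance E prs) S' /\ #|S'| <= p.
Proof.
move=> [SE cutS] Sp S'; split; last first.
  apply: leq_trans Sp.
  rewrite -(card_imset (mem S') (f := fun e => (emb e.1, emb e.2))).
    apply: subset_leq_card; apply/subsetP => _ /imsetP[e + ->].
    by rewrite inE => /andP[].
  by move=> [? ?] [? ?] [/val_inj/enum_rank_inj-> /val_inj/enum_rank_inj->].
split; first by apply/subsetP => e; rewrite inE => /andP[].
(* Passing through [ranked] gives the pair an index, hence a source and a sink. *)
move=> st /=; rewrite -{1}[prs]ranked2 => /mapP[[i st'] qs /= ->] {st}.
apply/negP => st_reach.
have ik : i < k := ranked_ltn qs.
have ik1 : i < k + k by lia.
have ik2 : k + i < k + k by lia.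
have /cutS : reachable (gadget_edge_set :\: S)
    (val (terminal ik1)) (val (terminal ik2)).
  apply: (@connect_trans _ _ (emb st'.1)).
    apply: (@reachable_copies _ _ _ (n + k + k) (i, st')) => //; try lia.
      by rewrite /=; lia.
    move=> m h hQ mE; rewrite !inE /= mE; split; apply/gadget_edgesP.
      exact: (SourceMid hQ).
    exact: (MidIn hQ).
  apply: (@connect_trans _ _ (emb st'.2)).
    case/connectP: st_reach => s; elim: s st'.1 => [|w s IH] v /=.
      by move=> _ ->; apply: connect0.
    case/andP => vw ws sE; apply: connect_trans (IH w ws sE).
    apply: reachable1; move: vw; rewrite /= in_setD inE => /andP[+ vwE].
    by rewrite in_setD emb_edge // vwE /= => ->.
  apply: (@reachable_copies _ _ _ (n + k + k + K) (i, st')) => //; try lia.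
    by have := rk_lt st'.2; rewrite /=; lia.
  move=> m h hQ mE; rewrite !inE /= mE; split; apply/gadget_edgesP.
    exact: (OutMid hQ).
  by rewrite addnA; exact: (MidSink hQ).
rewrite /Order.le /= /crown_le -val_eqE /=; lia.
Qed.

(** * From multicuts to lattice cuts *)

Lemma sink_no_out i j : gadget_edge_spec i j -> ~~ (n + k <= i < n + k + k).
Proof.
case=> [q|q|q|q|e] qQ; try (have [? ? ? ?] := copies_bounds qQ; lia).
by have := rk_lt e.1; lia.
Qed.

(* What can be reached from source i, when s is the start of the i-th pair. *)
Variant traversed (F : {set V * V}) i s : nat -> Prop :=
  | TrSource : traversed F i s (n + i)
  | TrIn (q : nat * (nat * (V * V))) of q \in ranked Q & q.2.1 = i :
      traversed F i s (n + k + k + q.1)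
  | TrVertex v of reachable F s v : traversed F i s (rk v)
  | TrOut (q : nat * (nat * (V * V))) of q \in ranked Q & reachable F s q.2.2.2 :
      traversed F i s (n + k + k + K + q.1)
  | TrSink (q : nat * (nat * (V * V))) of q \in ranked Q & reachable F s q.2.2.2 :
      traversed F i s (n + k + q.2.1).

(** The start of the edge appears as [a] and [a'] with an equation, so that both predicates can be
    inverted; as the blocks are disjoint, arithmetic leaves five of the twenty-five cases. *)
Lemma traversed_edge (F : {set V * V}) (i : nat) (st : V * V)
    a a' b :
  (i, st) \in ranked prs ->
  (forall e, e \in E -> a = rk e.1 -> b = rk e.2 -> e \in F) ->
  gadget_edge_spec a b -> traversed F i st.1 a' -> a = a' -> traversed F i st.1 b.
Proof.
move=> ist; have ik : i < k := ranked_ltn ist.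
move=> EF ab; case: ab EF => [q qQ|q qQ|q qQ|q qQ|e eE] EF tr;
  try have [? ? ? ?] := copies_bounds qQ;
  case: tr => [|r rQ rP|v vP|r rQ rP|r rQ rP] ee;
  try have [? ? ? ?] := copies_bounds rQ; try have := rk_lt v; try have := rk_lt e.1;
  try lia; move=> *.
- exact: TrIn qQ (addnI ee).
- have qr : q = r := ranked_inj qQ rQ (addnI ee).
  apply: TrVertex; rewrite qr.
  have -> : r.2 = (i, st) := ranked_inj (copies_ranked rQ) ist rP.
  exact: connect0.
- by apply: TrOut => //; rewrite (rk_inj ee).
- have qr : q = r := ranked_inj qQ rQ (addnI ee).
  by apply: TrSink => //; rewrite qr.
- apply: TrVertex; apply: connect_trans vP _; rewrite -(rk_inj ee).
  by apply: reachable1; rewrite -surjective_pairing; apply: EF.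
Qed.

Lemma traversed_terminal (F : {set V * V}) (i : nat) (st : V * V) j :
  (i, st) \in ranked prs -> ~~ reachable F st.1 st.2 ->
  traversed F i st.1 j -> n <= j < n + k + k ->
  j = n + i \/ n + k <= j /\ j <> n + k + i.
Proof.
move=> ist cut; case=> [|q qQ qi|v _|q qQ _|q qQ sq] jn; first by left.
- by lia.
- by have := rk_lt v; lia.
- by lia.
right; split; first by lia.
move=> /addnI qi; case/negP: cut.
by move: sq; rewrite (ranked_inj (copies_ranked qQ) ist qi).
Qed.

Lemma gadget_forth (S : {set V * V}) :
  is_multicut (I := MulticutInstance E prs) S -> #|S| <= p ->
  let S' := [set (emb e.1, emb e.2) | e in S] in
  is_lattice_cut (I := gadget) S' /\ #|S'| <= p.
Proof.
move=> [SE cutS] Sp S'; split; last exact: leq_trans (leq_imset_card _ _) Sp.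
split.
  by apply/subsetP => _ /imsetP[[u v] uv ->]; apply: emb_edge; apply: (subsetP SE).
move=> [x xT] [y yT] /= xy; set G := _ :\: S' in xy.
have [exy|nxy] := eqVneq x y.
  by case: y / exy yT {xy} => yT; rewrite (bool_irrelevance xT yT).
have edgeP e : e \in G -> gadget_edge_spec (val e.1) (val e.2).
  by rewrite !inE => /andP[_ /gadget_edgesP].
have := xT; have := yT; rewrite !inE => yn xn.
(* A sink reaches nothing but itself and [x] differs from [y], so [x] is a source. *)
have xk : x < n + k.
  rewrite ltnNge; apply/negP => nx; case/eqP: nxy.
  apply: (reachable_closed (R := fun v => x = v)) xy => // e /edgeP eE ex.
  by have := sink_no_out eE; rewrite -ex /=; lia.
pose i := x - n.
have ik : i < size prs by rewrite /i -/k; lia.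
have xE : x = n + i :> nat by rewrite /i; lia.
have [st ist] : exists st, (i, st) \in ranked prs.
  have : i \in map fst (ranked prs) by rewrite ranked1 mem_rev mem_iota.
  by case/mapP => -[j st] jst /= ->; exists st.
have st_cut : ~~ reachable (E :\: S) st.1 st.2.
  by apply: (cutS st); rewrite /= -[prs]ranked2; apply/mapP; exists (i, st).
have /(traversed_terminal ist st_cut) : traversed (E :\: S) i st.1 y.
  apply: (reachable_closed (R := fun v : 'I_N => traversed (E :\: S) i st.1 v)) xy.
    move=> e eG /= tr; apply: (traversed_edge ist _ (edgeP e eG) tr erefl).
    (* If the original edge [d] behind [e] were in [S], its image [e] would have been deleted. *)
    move=> d dE d1 d2; rewrite inE dE andbT; apply/negP => dS.
    move: eG; rewrite inE => /andP[/negP[]]; apply/imsetP; exists d => //.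
    by apply/eqP; rewrite -pair_eqE /pair_eq -!val_eqE /= d1 d2 !eqxx.
  by rewrite xE; apply: TrSource.
move=> /(_ ltac:(lia))[yE|[ky yi]].
  by case/eqP: nxy; apply: val_inj; rewrite /= yE xE.
rewrite /Order.le /= /crown_le; apply/orP; right; apply/and3P => /=.
by split; lia.
Qed.

End Gadget.

(** * Correctness of the encodings *)

Lemma listmap_edges A (f : A -> data) g h s i L :
  (forall a s', g (Node (f a) (code_seq f s')) = code_edge (h (size s', a))) ->
  perm_eq (items i) (map code_edge L) ->
  perm_eq (items (listmap g (code_seq f s) i))
    (map code_edge ([seq h q | q <- ranked s] ++ L)).
Proof.
move=> gh iL; rewrite map_cat -map_comp.
apply: perm_trans (items_listmap_seq (G := code_edge \o h) _ _ gh) _.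
by rewrite perm_cat2l.
Qed.

Lemma listmap_nat_edges g h n i L :
  (forall m, g (Node Leaf (code_nat m)) = code_edge (h m)) ->
  perm_eq (items i) (map code_edge L) ->
  perm_eq (items (listmap g (code_nat n) i))
    (map code_edge ([seq h m | m <- iota 0 n] ++ L)).
Proof.
move=> gh iL; rewrite map_cat -map_comp.
apply: perm_trans (items_listmap_nat _ _ _) _.
by rewrite (eq_map (g := code_edge \o h)) // perm_cat2l.
Qed.

Lemma flatmap_nat_edges g h n i L :
  (forall m, perm_eq (items (g (Node Leaf (code_nat m)))) (map code_edge (h m))) ->
  perm_eq (items i) (map code_edge L) ->
  perm_eq (items (flatmap g (code_nat n) i))
    (map code_edge (flatten [seq h m | m <- iota 0 n] ++ L)).
Proof.
move=> gh iL; apply: perm_trans (items_flatmap _ _ _) _.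
rewrite map_cat; apply: perm_cat => //.
rewrite map_suffixes_nat map_flatten -map_comp.
apply: perm_trans (perm_flatten (perm_map _ (introT permPl (perm_rev _)))) _.
by elim: (iota 0 n) => //= m s IH; apply: perm_cat.
Qed.

Definition code_copy (V : finType) (q : nat * (V * V)) : data :=
  Node (code_nat q.1) (code_pair q.2).

Section Encoding.

Variables (V : finType) (E : {set V * V}) (prs : seq (V * V)) (p : nat).
Variables e x : data.
Hypothesis eE : perm_eq (items e) (map (@code_pair _ _) (enum E)).
Hypothesis xE : x = Node (Node (code_nat #|V|)
  (Node e (code_seq (@code_pair _ _) prs))) (code_nat p).

Let n := #|V|.
Let k := size prs.

Lemma in_npairsE : in_npairs x = code_nat k.
Proof. by rewrite xE /in_npairs /= len_code_seq. Qed.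

Lemma out_copiesE : exists2 Q,
  perm_eq Q (flatten [seq nseq p.+1 q | q <- ranked prs]) &
  out_copies x = code_seq (@code_copy V) Q.
Proof.
have : perm_eq (items (out_copies x)) (map (@code_copy V)
    (flatten [seq nseq p.+1 q | q <- ranked prs])).
  apply: perm_trans (items_flatmap _ _ _) _; rewrite cats0 map_flatten -map_comp xE.
  rewrite (map_suffixes (G := fun q => nseq p.+1 (code_copy q))).
    rewrite -(@eq_map _ _ (map (@code_copy V) \o nseq p.+1)) // => q.
    by rewrite /= map_nseq.
  move=> a s; rewrite items_listmap_const /= items_code_nat size_nseq.
  by rewrite len_code_seq.
case/perm_map_preim => Q QP copiesE; exists Q => //.
by apply: items_inj; rewrite items_code_seq.
Qed.

Section Copies.

Variable Q : seq (nat * (V * V)).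
Hypothesis QP : perm_eq Q (flatten [seq nseq p.+1 q | q <- ranked prs]).
Hypothesis copiesE : out_copies x = code_seq (@code_copy V) Q.

Let K := size Q.

Lemma out_sinksE : out_sinks x = code_nat (n + k).
Proof. by rewrite /out_sinks in_npairsE xE revapp_code_nat. Qed.

Lemma out_in_midsE : out_in_mids x = code_nat (n + k + k).
Proof. by rewrite /out_in_mids out_sinksE in_npairsE revapp_code_nat. Qed.

Lemma out_out_midsE : out_out_mids x = code_nat (n + k + k + K).
Proof.
by rewrite /out_out_mids out_in_midsE copiesE len_code_seq revapp_code_nat.
Qed.

Lemma out_sizeE : out_size x = code_nat (n + k + k + K + K).
Proof. by rewrite /out_size out_out_midsE copiesE len_code_seq revapp_code_nat. Qed.

Lemma out_edgesP : codes_set (@code_pair _ _) (gadget_edge_set E prs Q) (out_edges x).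
Proof.
apply/codes_setP.
apply: perm_trans (perm_code_edges (uniq_gadget_edges E QP)
  (@gadget_edges_lt _ E _ _ _ QP) _); last by move=> d; rewrite inE.
rewrite /out_edges out_in_midsE out_out_midsE out_sinksE copiesE.
have nE : in_size x = code_nat n by rewrite xE.
rewrite nE /gadget_edges.
do 4![apply: listmap_edges => [a s /=|]; first by rewrite ?len_code_seq ?revapp_code_nat].
by rewrite xE -map_comp.
Qed.

Lemma out_labelsP : codes_set (fun y => code_pair (val y, gadget_label y))
  [set: {v | v \in gadget_terminals prs Q}] (out_labels x).
Proof.
apply/codes_setP.
apply: perm_trans (_ : perm_eq _ (map code_edge [seq (n + m, m) | m <- iota 0 (k + k)])) _.
  rewrite /out_labels in_npairsE revapp_code_nat -[map code_edge _]cats0.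
  rewrite -[[::]]/(map code_edge [::]) -map_cat.
  by apply: listmap_nat_edges => // m; rewrite xE /= revapp_code_nat.
have -> : [seq code_pair (val y, gadget_label y)
      | y <- enum [set: {v | v \in gadget_terminals prs Q}]]
    = map code_edge [seq (n + m, m) | m <- [seq val (gadget_label y)
      | y <- enum [set: {v | v \in gadget_terminals prs Q}]]].
  rewrite -!map_comp; apply: eq_map => y.
  rewrite /code_pair /= code_elt_ord (code_elt_ord (gadget_label y)) /=.
  congr Node; congr code_nat.
  by case: y => y yT /=; move: yT; rewrite inE -/n; lia.
do 2!apply: perm_map; rewrite perm_sym; apply: uniq_perm; rewrite ?iota_uniq //.
  rewrite map_inj_uniq ?enum_uniq // => -[y yT] [z zT] /= yz.
  apply: val_inj; apply: val_inj => /=.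
  by move: yT zT yz; rewrite !inE -/n; lia.
move=> i; rewrite mem_iota; apply/mapP/idP => [[y] _ ->|ik] /=.
  exact: (ltn_ord (gadget_label y)).
have [y yE] := gadget_label_surj Q (Ordinal (ik : i < k + k)).
exists y; first by rewrite mem_enum inE.
exact: esym (congr1 val yE).
Qed.

Lemma out_orderP : codes_set (@code_pair _ _)
  [set ab : crown k * crown k | (ab.1 <= ab.2)%O] (out_order x).
Proof.
(* The two halves mirror the disjunction in [crown_le]: the diagonal and the strict comparisons. *)
pose L := [seq (m, m) | m <- iota 0 (k + k)] ++
  (flatten [seq [seq (k + m, m') | m' <- iota 0 k & m != m'] | m <- iota 0 k] ++ [::]).
apply/codes_setP.
apply: perm_trans (_ : perm_eq _ (map code_edge L)) _.
  rewrite /out_order in_npairsE revapp_code_nat.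
  apply: listmap_nat_edges => //.
  apply: flatmap_nat_edges => // m /=.
  have -> : [seq (k + m, m') | m' <- iota 0 k & m != m']
      = flatten [seq if m != m' then [:: (k + m, m')] else [::] | m' <- iota 0 k] ++ [::].
    by rewrite cats0; elim: (iota 0 k) => //= m' s <-; case: eqP.
  apply: flatmap_nat_edges => // m' /=; rewrite /dtest revapp_code_nat.
  have -> : data_eq (code_nat m) (code_nat m') = (m == m').
    by rewrite -[data_eq _ _]/(_ == _) (inj_eq code_nat_inj).
  by case: eqP.
apply: (@perm_code_edges (k + k) (k + k)).
- rewrite /L cats0 cat_uniq; apply/and3P; split.
  + by rewrite map_inj_uniq ?iota_uniq // => ? ? [].
  + apply/hasPn => d /allpairsPdep[m [m' []]]; rewrite mem_filter !mem_iota.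
    by move=> ? /andP[? ?] ->; apply/mapP => -[i _ [? ?]]; lia.
  + apply: allpairs_uniq_dep; first exact: iota_uniq.
      by move=> m _; rewrite filter_uniq ?iota_uniq.
    by move=> [m m'] [l l'] _ _ /= [/addnI-> ->].
- move=> d; rewrite /L cats0 mem_cat => /orP[/mapP[i + ->]|].
    by rewrite mem_iota.
  move=> /allpairsPdep[m [m' []]]; rewrite mem_filter !mem_iota.
  by move=> ? /andP[? ?] -> /=; lia.
move=> [a b]; rewrite inE /Order.le /= /crown_le /L cats0 mem_cat; congr orb.
  apply/eqP/mapP => [->|[i _ [ai bi]]].
    by exists (val b); rewrite ?mem_iota ?(ltn_ord b).
  by apply: val_inj; rewrite /= ai bi.
apply/and3P/allpairsPdep => [[ka bk ab]|[m [m' []]]].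
  exists (a - k), (b : nat); rewrite mem_filter !mem_iota.
  have := ltn_ord a; split; try lia.
  by rewrite subnKC.
by rewrite mem_filter !mem_iota => ? /andP[? ?] [-> ->]; split; lia.
Qed.

Lemma reductionE : codes_input lattice_cut (gadget E prs Q) p (reduction x).
Proof.
exists (dleft (reduction x)); last first.
  by rewrite /reduction /in_budget xE.
exists (out_edges x), (out_labels x), (out_order x); split.
- exact: out_edgesP.
- exact: out_labelsP.
- exact: out_orderP.
- by rewrite /reduction [dleft _]/= in_npairsE revapp_code_nat out_sizeE !card_ord.
Qed.

End Copies.

End Encoding.

Lemma reduction_correct (I : multicut_instance) p x :
  codes_input directed_multicut I p x -> exists2 Q,
  perm_eq Q (flatten [seq nseq p.+1 q | q <- ranked (dm_pairs I)]) &
  codes_input lattice_cut (gadget (dm_E I) (dm_pairs I) Q) p (reduction x).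
Proof.
case=> _ [e /codes_setP eE ->] xE; have [Q QP copiesE] := out_copiesE xE.
exists Q => //. exact: (reductionE eE xE QP copiesE).
Qed.

(** * Recovering multicuts from lattice cuts *)

Definition member (a l : data) : data :=
  flatmap (fun w => dif (dtest a (dleft w)) (Node Leaf Leaf) Leaf) l Leaf.

Lemma map_dleft_suffixes l : map dleft (suffixes l) = items l.
Proof. by elim: l => //= a _ l ->. Qed.

Lemma dif_member a l u v : dif (member a l) u v = if a \in items l then u else v.
Proof.
have := items_flatmap (fun w => dif (dtest a (dleft w)) (Node Leaf Leaf) Leaf) l Leaf.
rewrite cats0 -/(member a l) => /perm_size.
have -> : [seq items (dif (dtest a (dleft w)) (Node Leaf Leaf) Leaf) | w <- suffixes l]
    = [seq if a == b then [:: Leaf] else [::] | b <- items l].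
  rewrite -map_dleft_suffixes -map_comp; apply: eq_map => w /=.
  by rewrite /dtest -[data_eq _ _]/(_ == _); case: eqP.
have -> : (a \in items l)
    = (0 < size (flatten [seq if a == b then [:: Leaf] else [::] | b <- items l])).
  by elim: (items l) => //= b s; rewrite inE => ->; case: eqP.
by case: (member a l) => [|? ?] <-.
Qed.

Definition select (l l' : data) : data :=
  flatmap (fun w => dif (member (dleft w) l') (Node (dleft w) Leaf) Leaf) l Leaf.

Lemma items_select l l' :
  perm_eq (items (select l l')) [seq a <- items l | a \in items l'].
Proof.
apply: perm_trans (items_flatmap _ _ _) _; rewrite cats0 -(map_dleft_suffixes l).
elim: (suffixes l) => //= w s IH; rewrite dif_member.
by case: ifP => //= _; rewrite perm_cons.
Qed.

(** An original edge and its image have the same code, so intersecting the edge list of the input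
    with the answer pulls the cut back. *)
Definition recovery (z : data) : data :=
  dif (dright z) (Node Leaf (select (in_edges (dleft z)) (dright (dright z)))) Leaf.

Lemma ptime_recovery : ptime recovery.
Proof. by rewrite /recovery /in_edges /select /member; ptime_auto. Qed.

Lemma code_elt_inj (A : finType) : injective (@code_elt A).
Proof. by move=> a b /code_nat_inj/val_inj/enum_rank_inj. Qed.

Lemma code_pair_inj (A B : finType) : injective (@code_pair A B).
Proof. by move=> [a b] [c d] [/code_elt_inj -> /code_elt_inj ->]. Qed.

Lemma recovery_correct (I : multicut_instance) p x Q y :
  codes_input directed_multicut I p x ->
  perm_eq Q (flatten [seq nseq p.+1 q | q <- ranked (dm_pairs I)]) ->
  @answers lattice_cut (gadget (dm_E I) (dm_pairs I) Q) p y ->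
  @answers directed_multicut I p (recovery (Node x y)).
Proof.
case: I Q => V E prs /= Q [_ [e /codes_setP eE ->] xE] QP.
case=> [[S' [d [[cutS' S'p] /codes_setP dE ->]]]|[-> noS']]; last first.
  right; split=> // -[S [cutS Sp]]; apply: noS'.
  by have [? ?] := gadget_forth QP cutS Sp; eexists; split; eassumption.
left; have [cutS Sp] := gadget_back QP cutS' S'p.
eexists _, _; split; [by split; [exact: cutS|exact: Sp]| |reflexivity].
apply/codes_setP; rewrite xE /in_edges /=.
apply: perm_trans (items_select _ _) _.
apply: perm_trans (perm_filter _ eE) _; rewrite filter_map; apply: perm_map.
apply: uniq_perm; first exact: filter_uniq (enum_uniq _).
  exact: enum_uniq.
move=> [u v].
rewrite mem_filter !mem_enum !inE andbC; congr andb.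
rewrite /= (perm_mem dE).
have -> : code_pair (u, v) = code_pair (emb prs Q u, emb prs Q v).
  by rewrite /code_pair /= !code_elt_ord.
by rewrite (mem_map (@code_pair_inj _ _)) mem_enum.
Qed.

(** * Fixed-parameter tractability *)

Lemma dsize_code_pair (A : finType) (e : A * A) :
  dsize (code_pair e) <= 4 * #|A| + 3.
Proof.
rewrite /= !dsize_code_nat -/(rk e.1) -/(rk e.2).
set n := #|A|.
by have : rk e.1 < n := rk_lt _; have : rk e.2 < n := rk_lt _; lia.
Qed.

Lemma dsize_code_seq A (f : A -> data) s B :
  (forall a, dsize (f a) <= B) -> dsize (code_seq f s) <= 1 + size s * B.+1.
Proof. by move=> fB; elim: s => //= a s IH; have := fB a; lia. Qed.

(** The solver's running time would also bound [y], but then a power of [f] would enter the time of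
    the recovery. Counting keeps [f] out: there are at most [p] edges, [p] is in unary in [x], and
    each code is linear in the number of vertices. *)
Lemma dsize_answer (J : lattice_instance) p x y :
  codes_input lattice_cut J p x -> @answers lattice_cut J p y ->
  dsize y <= 3 + dsize x * (4 * dsize x + 4).
Proof.
case=> _ [e [l [r [_ _ _ ->]]]] xE [[S [_ [[_ Sp] [s sS ->] ->]]]|[-> _]] //=.
have Vx : #|lc_V J| <= dsize x by rewrite xE /= dsize_code_nat; lia.
have sx : size s <= dsize x.
  rewrite (perm_size sS) -cardE; apply: leq_trans Sp _.
  by rewrite xE /= !dsize_code_nat; lia.
have {}Vx d : dsize (@code_pair (lc_V J) (lc_V J) d) <= 4 * dsize x + 3.
  by apply: leq_trans (dsize_code_pair d) _; rewrite leq_add2r leq_mul2l.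
have := leq_trans (dsize_code_seq s Vx) (leq_add (leqnn 1) (leq_mul sx (leqnn _))).
by rewrite addn3 addn4; move: (dsize (code_seq _ _)) (dsize x * _) => ? ?; lia.
Qed.

Lemma computable2_double f :
  computable2 f -> computable2 (fun k p => (f (k + k) p).+1).
Proof.
case=> cf fP.
have dP : ptime (fun z => Node (revapp (dleft z) (dleft z)) (dright z)).
  by ptime_auto.
have [cd [T [_ dC]]] := ptime_call dP.
exists (Seq (Seq (call 1 cd (EVar 0)) (call 2 cf (EVar 1)))
  (Assign 0 (ENode ELeaf (EVar 2)))) => k p.
set x := Node _ _; have [t fr] := fP (k + k) p.
have [t1 [u1 [x1 _ e1 _]]] := dC 1 (EVar 0) (update (fun=> Leaf) 0 x) x erefl.
rewrite /= revapp_code_nat in e1.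
rewrite -e1 in fr; have [u2 [x2 e2 _]] := @exec_call 2 cf (EVar 1) u1 _ _ fr.
eexists; eexists; first exact: ExecSeq (ExecSeq x1 x2) (ExecAssign _ _ _).
by rewrite /update /= e2.
Qed.

Lemma fpt_transfer : fpt lattice_cut -> fpt directed_multicut.
Proof.
case=> c [f [a [b [fP cP]]]].
have [cr [Tr [TrP rC]]] := ptime_call ptime_reduction.
have [cb [Tb [[a' [b' TbP]] bC]]] := ptime_call ptime_recovery.
have [a2 [b2 recP]] := ptime_dsize ptime_recovery.
pose s x := dsize (reduction x).
(* [Y] bounds the size of the solver's answer; [G] collects all costs that do not involve [f]. *)
pose Y x := 3 + s x * (4 * s x + 4).
pose G x := 10 * (dsize x + s x + Y x) + 10 + prog_vars c + Tr x
  + a' * (dsize x + Y x).+1 ^ b' + a2 * (dsize x + Y x).+1 ^ b2.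
have sP : pbounded s := ptime_dsize ptime_reduction.
have YP : pbounded Y by rewrite /Y; pbounded_auto.
have GP : pbounded (fun x => G x + a * s x ^ b).
  have ZP : pbounded (fun x => (dsize x + Y x).+1).
    by apply: (@pbounded_le _ (fun x => 1 + (dsize x + Y x))) => //; pbounded_auto.
  by rewrite /G; pbounded_auto.
case: GP => [A [B GP]].
(* Variable 0 keeps the original input, whose edge list the recovery needs besides the answer. *)
exists (Seq (Seq (Seq (call 1 cr (EVar 0)) (call 2 c (EVar 1)))
  (call 3 cb (ENode (EVar 0) (EVar 2)))) (Assign 0 (EVar 3))).
exists (fun k p => (f (k + k) p).+1), A, B.
split; first exact: computable2_double.
move=> I p x xI; have [Q QP xJ] := reduction_correct xI.
have [y [t [yr yJ tb]]] := cP _ _ _ xJ.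
have ys := dsize_answer xJ yJ.
have [t1 [u1 [x1 b1 e1 o1]]] := rC 1 (EVar 0) (update (fun=> Leaf) 0 x) x erefl.
rewrite -e1 in yr.
have [u2 [x2 e2 o2]] := @exec_call 2 c (EVar 1) u1 _ _ yr.
have u20 : u2 0 = x by rewrite o2 // o1.
have [|t3 [u3 [x3 b3 e3 o3]]] := bC 3 (ENode (EVar 0) (EVar 2)) u2 (Node x y).
  by rewrite /= u20 e2.
exists (recovery (Node x y)); eexists; split.
- eexists; first exact: ExecSeq (ExecSeq (ExecSeq x1 x2) x3) (ExecAssign _ _ _).
  by rewrite /update /= e3.
- exact: recovery_correct xI QP yJ.
apply: leq_trans (leq_mul (leqnn _) (GP x)).
have Tb3 : t3 <= a' * (dsize x + Y x).+1 ^ b'.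
  apply: leq_trans b3 _; apply: leq_trans (TbP _) _; apply: leq_mul => //.
  by apply: leq_expn2l; rewrite /= ltnS leq_add2l.
rewrite /= card_gadget_terminals -/(s x) in tb.
have rs : dsize (recovery (Node x y)) <= a2 * (dsize x + Y x).+1 ^ b2.
  apply: leq_trans (recP _) _; apply: leq_mul => //.
  by apply: leq_expn2l; rewrite /= ltnS leq_add2l.
rewrite /= e3 u20 e2 e1 -/(s x).
have -> : update (fun=> Leaf) 0 x 0 = x by [].
have {}ys : dsize y <= Y x by [].
(* In the product of [f + 1] with [G x + a * s x ^ b], the added 1 pays for [G x] even where [f]
   vanishes. *)
rewrite mulSn mulnDr /G; move: (f _ _ * _) (f _ _ * _) tb => Z1 Z2 tb.
by lia.
Qed.

Theorem theorem1 :
  (exists (c : prog) (a b : nat),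
     forall (I : multicut_instance) (p : nat) (x : data),
       codes_input directed_multicut I p x ->
       exists (J : lattice_instance) (y : data) (t : nat),
         run c x y t /\
         t <= a * dsize x ^ b /\
         codes_input lattice_cut J p y /\
         #|lc_T J| <= 2 * size (dm_pairs I) /\
         ((exists S : {set lc_V J * lc_V J}, solution lattice_cut J p S) <->
          (exists S : {set dm_V I * dm_V I}, solution directed_multicut I p S)))
  /\
  (fpt lattice_cut -> fpt directed_multicut).
Proof.
split; last exact: fpt_transfer.
have [c [T [[a [b TP]] cP]]] := ptime_reduction.
exists c, a, b => I p x xI; have [Q QP xJ] := reduction_correct xI.
have [t xr tT] := cP x.
exists (gadget (dm_E I) (dm_pairs I) Q), (reduction x), t.
split; first exact: xr.
split; first exact: leq_trans tT (TP x).
split; first exact: xJ.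
split; first by rewrite /= card_gadget_terminals mul2n addnn.
case: I Q QP {xI xJ} => V E prs /= Q QP; split=> -[S [cutS Sp]].
  by have [? ?] := gadget_back QP cutS Sp; eexists; split; eassumption.
by have [? ?] := gadget_forth QP cutS Sp; eexists; split; eassumption.
Qed.
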